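(* Let $G$ be a finite group, $K\le G$, $X=G/K$, and let $G=H_m\ge H_{m-1}\ge\cdots\ge H_2\ge H_1=K$ be a chain of subgroups satisfying the Gelfand--Tsetlin condition. Let $(\rho,V_\rho)$ be an irreducible representation of $G$ contained in $L(X)$, with multiplicity $m_\rho$, and let $\mathcal{C}(\rho)$ be the set of all paths in the associated Bratteli diagram ending in $\rho$. Then $$m_\rho V_\rho=\bigoplus_{C\in\mathcal{C}(\rho)}V_C$$ is an orthogonal decomposition of the $\rho$-isotypic component of $L(X)$. Moreover, for every $C\in\mathcal{C}(\rho)$, the intertwining operator $T_{v_C}$ associated with the Gelfand--Tsetlin vector $v_C$ maps $V_\rho$ into $V_C$.
   Context: All representations are finite-dimensional, complex and unitary. $L(X)$ is the space of complex functions on $X$ with $\langle f_1,f_2\rangle=\sum_{x\in X}f_1(x)\overline{f_2(x)}$ and the permutation action of $G$. The point of $X$ stabilized by $K$ is $x_0$, and $V^K$ is the subspace of $K$-invariant vectors of a representation $V$. $m_\rho V_\rho$ denotes the $\rho$-isotypic component of $L(X)$. Gelfand--Tsetlin condition: for every $j=1,\dots,m-1$ and every irreducible $H_j$-representation $V$ containing nonzero $K$-invariant vectors, $\mathrm{Ind}_{H_j}^{H_{j+1}}V$ decomposes without multiplicity into irreducible $H_{j+1}$-representations (equivalently, if $W$, $V$ are irreducible representations of $H_{j+1}$, $H_j$ both containing nonzero $K$-invariant vectors, then the multiplicity of $V$ in $\mathrm{Res}^{H_{j+1}}_{H_j}W$ is at most $1$). Bratteli diagram: let $\mathcal{B}_j$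 be the set of (equivalence classes of) irreducible representations of $H_j$ containing nonzero $K$-invariant vectors; so $\mathcal{B}_1=\{\iota_K\}$ with $\iota_K$ the trivial representation. The vertex set is $\bigcup_j\mathcal{B}_j$, and $\sigma\in\mathcal{B}_j$, $\theta\in\mathcal{B}_{j+1}$ are joined by an edge when $\mathrm{Res}^{H_{j+1}}_{H_j}\theta$ contains $\sigma$. A path is a sequence $\rho_1,\dots,\rho_m$ with $\rho_j\in\mathcal{B}_j$ and $\{\rho_j,\rho_{j+1}\}$ an edge for all $j$. The vectors $v_C$: given a path $C:\rho_1,\dots,\rho_m=\rho$, there are unique subspaces $V_\rho=V_m\supseteq V_{m-1}\supseteq\cdots\supseteq V_1$ such that $V_j$ is an $H_j$-invariant subspace of $V_{j+1}$ isomorphic to $\rho_j$. Then $V_1$ is one-dimensional and spanned by a $K$-invariant vector; $v_C\in V_1$ is a vector of norm $1$ (defined up to a scalar of modulus 1). The set $\{v_C: C\in\mathcal{C}(\rho)\}$ is the Gelfand--Tsetlin basis of $V_\rho^K$. The operator $T_v$: for $v\in V_\rho^K$, $T_v:V_\rho\to L(X)$ is $(T_vw)(gx_0)=\sqrt{d_\rho/|X|}\,\langle w,\rho(g)v\rangle$, where $d_\rho=\dim V_\rho$. The subspaces $V_C$: regard $L(H_j/K)$ as the space of functions in $L(H_{j+1}/K)$ supported on $H_j/K$; for an $H_j$-invariant subspace $U\le L(H_j/K)$, $\mathrm{Ind}_{H_j}^{H_{j+1}}U$ is realized as the subspace $\bigoplus_s sU$ of $L(H_{j+1}/K)$, with $s$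 running over representatives of the cosets $sH_j$ in $H_{j+1}$. Given $C:\rho_1,\dots,\rho_m$, start from $V_1=L(K/K)\cong\mathbb{C}$; inductively let $V_{j+1}$ be the unique subspace of $\mathrm{Ind}_{H_j}^{H_{j+1}}V_j\le L(H_{j+1}/K)$ isomorphic to $\rho_{j+1}$. Then $V_C$ is the subspace $V_m\le L(X)$ so obtained. *)

(* Defs.v *)
From HB Require Import structures.
From mathcomp Require Import all_boot all_order all_algebra.
From mathcomp Require Import all_fingroup all_solvable all_character.
From mathcomp Require Import boolp classical_sets.

Set Implicit Arguments.
Unset Strict Implicit.
Unset Printing Implicit Defensive.

Import Order.TTheory GRing.Theory Num.Theory.
Local Open Scope ring_scope.

(* The scalars are an arbitrary numClosedFieldType C, which covers the complex
   numbers R[i] over any realType R.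

   An mx_representation rG of G acts on row vectors from the right, so the
   left representation it encodes is g . w = w *m rG g^-1. Invariant subspaces,
   invariant vectors and isomorphisms are the same for the two actions. *)

Definition lact (C : fieldType) (gT : finGroupType) (G : {group gT}) (n : nat)
    (rG : mx_representation C G n) (p : nat) (g : gT) (U : 'M[C]_(p, n)) :
    'M[C]_(p, n) :=
  U *m rG g^-1%g.

(* L(X) for X = G/K: the row f is the function with value f 0 i at the left
   coset enum_val i. The matrix of g sends f to x |-> f (g x), whence
   (lact (LX_repr C G K) g f) x = f (g^-1 x). *)

Definition LX_mx (C : fieldType) (gT : finGroupType) (G K : {group gT})
    (g : gT) : 'M[C]_#|lcosets K G| :=
  \matrix_(i, j) (enum_val i == g *: enum_val j :> {set gT})%g%:R.

Lemma LX_mx_repr (C : fieldType) (gT : finGroupType) (G K : {group gT}) :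
  mx_repr G (@LX_mx C gT G K).
Proof.
split=> [|g h gG hG]; apply/matrixP=> i j.
  by rewrite !mxE mul1g (inj_eq enum_val_inj).
have hjX : (h *: enum_val j)%g \in lcosets K G.
  have /lcosetsP[x xG ->] := enum_valP j.
  by rewrite -lcosetM; apply/lcosetsP; exists (h * x)%g; rewrite ?groupM.
rewrite !mxE (bigD1 (enum_rank_in hjX (h *: enum_val j)%g)) //= !mxE.
rewrite enum_rankK_in // eqxx mulr1 -lcosetM big1 ?addr0 // => k.
rewrite !mxE => /negPf nk; case: (enum_val k =P _) => [ek|]; last by rewrite mulr0.
by move: nk; rewrite -{1}(enum_valK_in hjX k) ek eqxx.
Qed.

Canonical LX_repr (C : fieldType) (gT : finGroupType) (G K : {group gT}) :
    mx_representation C G #|lcosets K G| :=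
  MxRepresentation (LX_mx_repr C G K).

(* U is an H-invariant subspace of the representation rG of G, for a subgroup
   H of G, on which H acts by a representation isomorphic to sigma. *)
Definition is_copy (C : fieldType) (gT : finGroupType) (G H : {group gT})
    (n d : nat) (rG : mx_representation C G n)
    (sigma : mx_representation C H d) (U : 'M[C]_n) : Prop :=
  exists (sHG : H \subset G) (modU : mxmodule (subg_repr rG sHG) U),
    mx_rsim sigma (submod_repr modU).

Definition has_invariants (C : fieldType) (gT : finGroupType)
    (H K : {group gT}) (d : nat) (sigma : mx_representation C H d) : bool :=
  rfix_mx sigma K != 0.

(* The sum of the translates s U over representatives s of the left cosets
   s H contained in L. *)
Definition ind_space (C : fieldType) (gT : finGroupType) (G : {group gT})
    (n : nat) (rG : mx_representation C G n) (H L : {group gT})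
    (U : 'M[C]_n) : 'M[C]_n :=
  (\sum_(A in lcosets H L) lact rG (repr A) U)%MS.

(* theta is (isomorphic to) Ind_H^L sigma: its space is the direct sum of the
   translates s U of an H-invariant subspace U isomorphic to sigma. *)
Definition is_induced (C : fieldType) (gT : finGroupType) (H L : {group gT})
    (d n : nat) (sigma : mx_representation C H d)
    (theta : mx_representation C L n) : Prop :=
  exists U : 'M[C]_n,
    [/\ is_copy theta sigma U,
        mxdirect (\sum_(A in lcosets H L) lact theta (repr A) U)
      & (ind_space theta H L U :=: 1%:M)%MS].

Definition multiplicity_free (C : fieldType) (gT : finGroupType)
    (L : {group gT}) (n : nat) (theta : mx_representation C L n) : Prop :=
  exists (I : finType) (W : I -> 'M[C]_n),
    [/\ forall i, mxsimple theta (W i),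
        forall i j, i != j -> ~ mx_iso theta (W i) (W j),
        mxdirect (\sum_i W i)
      & (\sum_i W i :=: 1%:M)%MS].

(* A chain H_1 <= ... <= H_m is indexed from 0 as H : 'I_m.+1 -> {group gT},
   so that K = H ord0 and G = H ord_max; the consecutive indices i and i.+1,
   for i : 'I_m, are written inord i and inord i.+1. *)

Definition Gelfand_Tsetlin (C : fieldType) (gT : finGroupType) (m : nat)
    (H : 'I_m.+1 -> {group gT}) (K : {group gT}) : Prop :=
  forall (i : 'I_m) (d : nat) (sigma : mx_representation C (H (inord i)) d),
    mx_irreducible sigma -> has_invariants K sigma ->
  forall (n : nat) (theta : mx_representation C (H (inord i.+1)) n),
    is_induced sigma theta -> multiplicity_free theta.

(* The finite type of equivalence classes of irreducible representations. *)
Definition Irr (C : numClosedFieldType) (gT : finGroupType)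
    (G : {group gT}) : irrType C G :=
  DecSocleType (regular_repr C G).

Definition edge (C : numClosedFieldType) (gT : finGroupType)
    (H L : {group gT}) (sigma : Irr C H) (theta : Irr C L) : Prop :=
  exists U, is_copy (irr_repr theta) (irr_repr sigma) U.

Definition pathType (C : numClosedFieldType) (gT : finGroupType) (m : nat)
    (H : 'I_m.+1 -> {group gT}) : finType :=
  {dffun forall j : 'I_m.+1, Irr C (H j)}.

(* The last condition says that the class at the end of the path is that of
   the representation rho of G = H ord_max. *)
Definition path_to (C : numClosedFieldType) (gT : finGroupType) (m : nat)
    (H : 'I_m.+1 -> {group gT}) (K G : {group gT}) (n : nat)
    (rho : mx_representation C G n) (c : pathType C H) : Prop :=
  [/\ forall j : 'I_m.+1, has_invariants K (irr_repr (c j)),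
      forall i : 'I_m, edge (c (inord i)) (c (inord i.+1))
    & is_copy rho (irr_repr (c ord_max)) 1%:M].

(* v is a possible choice of the vector v_c. *)
Definition GT_vector (C : numClosedFieldType) (gT : finGroupType) (m : nat)
    (H : 'I_m.+1 -> {group gT}) (G : {group gT}) (n : nat)
    (rho : mx_representation C G n) (c : pathType C H) (v : 'rV[C]_n) : Prop :=
  exists V : 'I_m.+1 -> 'M[C]_n,
    [/\ (V ord_max :=: 1%:M)%MS,
        forall i : 'I_m, (V (inord i) <= V (inord i.+1))%MS,
        forall j : 'I_m.+1, is_copy rho (irr_repr (c j)) (V j),
        (v <= V ord0)%MS
      & dotmx v v = 1].

(* (T_v w)(x) at x = g x_0 with g = repr x; for a K-invariant v this does not
   depend on the choice of g in the coset x. *)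
Definition intertwiner (C : numClosedFieldType) (gT : finGroupType)
    (G K : {group gT}) (n : nat) (rho : mx_representation C G n)
    (v w : 'rV[C]_n) : 'rV[C]_#|lcosets K G| :=
  \row_i (sqrtC (n%:R / #|lcosets K G|%:R)
          * dotmx w (lact rho (repr (enum_val i)) v)).

(* The line L(K/K) of functions supported at the point x_0 = K of X. *)
Definition LKK (C : fieldType) (gT : finGroupType) (G K : {group gT}) :
    'M[C]_#|lcosets K G| :=
  <<\row_i (enum_val i == K :> {set gT})%:R>>%MS.

(* The subspace of W isomorphic to sigma, when it is unique. *)
Definition the_copy (C : numClosedFieldType) (gT : finGroupType)
    (G H : {group gT}) (n d : nat) (rG : mx_representation C G n)
    (sigma : mx_representation C H d) (W : 'M[C]_n) : 'M[C]_n :=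
  xget 0 (fun U => (U <= W)%MS /\ is_copy rG sigma U).

(* All L(H_j/K) are regarded as subspaces of L(X), and the induced spaces are
   formed inside L(X). *)
Fixpoint VC_step (C : numClosedFieldType) (gT : finGroupType) (m : nat)
    (H : 'I_m.+1 -> {group gT}) (G K : {group gT}) (c : pathType C H)
    (j : nat) : 'M[C]_#|lcosets K G| :=
  if j is i.+1 then
    the_copy (LX_repr C G K) (irr_repr (c (inord i.+1)))
      (ind_space (LX_repr C G K) (H (inord i)) (H (inord i.+1))
         (VC_step G K c i))
  else LKK C G K.

Definition VC (C : numClosedFieldType) (gT : finGroupType) (m : nat)
    (H : 'I_m.+1 -> {group gT}) (G K : {group gT}) (c : pathType C H) :
    'M[C]_#|lcosets K G| :=
  VC_step G K c m.

(* Main.v *)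
Require Import Defs.
From mathcomp Require Import all_boot all_order all_algebra.
From mathcomp Require Import all_fingroup all_solvable all_character.
From mathcomp Require Import boolp.

Import GRing.Theory Num.Theory.
Local Open Scope ring_scope.
Local Open Scope sesquilinear_scope.

Set Implicit Arguments.
Unset Strict Implicit.
Unset Printing Implicit Defensive.

(** Along the chain H_1 <= ... <= H_m the subsets H_j/K grow from the base point
    of X = G/K to the whole of X, and the restriction of functions to H_j/K is a
    projection P_j of L(X) that is H_j-equivariant and whose translates by
    elements of G outside H_j are supported away from H_j/K. Inducing from H_j
    to H_{j+1} inside L(X) is thus a direct sum of translates (a system of
    imprimitivity), and for a subspace U supported on H_j/K:

    - Frobenius reciprocity, obtained by averaging over the groups, says that
      an irreducible theta of H_{j+1} occurs in Ind U exactly when the type of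
      U occurs in the restriction of theta ([ind_copy_exists],
      [ind_copy_edge]);
    - by the Gelfand-Tsetlin condition it then occurs there as exactly one
      subspace ([ind_copy_uniq]).

    Hence every initial segment of a path determines a subspace of L(H_j/K) of
    the type named by its last vertex ([VC_step_copy]). By induction on j these
    subspaces are pairwise orthogonal ([VC_step_orth]): induction preserves
    orthogonality, and two segments that separate at the last vertex give
    non-isomorphic irreducible subspaces of a unitary representation. They also
    exhaust L(H_j/K) ([supp_mx_sub_sum]): L(H_{j+1}/K) is induced from
    L(H_j/K), and each irreducible constituent of an induced summand continues
    the segment by one edge. At j = m this decomposes L(X) orthogonally along
    all paths; the terms whose path does not end in rho are orthogonal to the
    rho-isotypic component, so the others fill it ([component_VC]).

    For the intertwiner, let T be T_v without its scalar factor. The operator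
    T P_j sends w to the coefficient function <w, h v> on H_j/K; it kills the
    orthogonal complement of the subspace V_j of the tower attached to the
    path, because h v stays in V_j. So its image is an image of the irreducible
    H_j-space V_j. As P_{j+1} is the sum of the translates of P_j, the image of
    T P_{j+1} lies in the space induced from the image of T P_j, and uniqueness
    of copies there forces it, by induction, into the subspace of the path
    ([intertwiner_VC]). *)

(** * Copies of a representation as images of intertwining matrices *)

(** Stated for functions, so that a representation of a larger group needs no
    restriction to H. *)
Definition intertwines (F : fieldType) (gT : finGroupType) (H : {group gT})
    (d n : nat) (f : gT -> 'M[F]_d) (g : gT -> 'M[F]_n) (B : 'M[F]_(d, n)) :=
  forall h, h \in H -> f h *m B = B *m g h.

Lemma intertwines_module (F : fieldType) (gT : finGroupType) (H : {group gT})
    (d n : nat) (f : gT -> 'M[F]_d) (rH : mx_representation F H n)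
    (B : 'M[F]_(d, n)) :
  intertwines H f rH B -> mxmodule rH <<B>>%MS.
Proof.
move=> homB; apply/mxmoduleP=> h hH.
by rewrite (eqmxMr _ (genmxE _)) genmxE -homB ?submxMl.
Qed.

Section Copies.

Context {F : fieldType} {gT : finGroupType} {G H : {group gT}} {n : nat}.
Context {rG : mx_representation F G n}.

(** An embedding matrix carries the same information as a subspace with an
    isomorphism, but composes with other matrices and is insensitive to the
    ambient group; every later argument about copies goes through it. *)
Lemma is_copyP d (sigma : mx_representation F H d) (U : 'M_n) :
  is_copy rG sigma U <->
  H \subset G /\
  exists B : 'M_(d, n),
    [/\ row_free B, (B :=: U)%MS & intertwines H sigma rG B].
Proof.
split=> [[sHG [modU [B0 ed freeB0 homB0]]]|[sHG [B [freeB eqBU homB]]]].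
  split=> //; exists (val_submod B0).
  have rkB : \rank (val_submod B0) = \rank U.
    by rewrite mxrankMfree ?row_base_free // (eqnP freeB0) ed.
  split; first by rewrite /row_free rkB -ed.
    apply/eqmxP; rewrite -mxrank_leqif_eq ?val_submodP //; exact/eqP.
  move=> h hH; rewrite val_submodE mulmxA homB0 // -val_submodE.
  by rewrite (val_submodJ modU B0 hH) [in LHS]val_submodE.
have modU : mxmodule (subg_repr rG sHG) U.
  apply/mxmoduleP=> h hH.
  by rewrite -(eqmxMr _ eqBU) -eqBU -homB // submxMl.
exists sHG, modU; apply: (MxReprSim (B := in_submod U B)).
- by rewrite -eqBU (eqnP freeB).
- rewrite /row_free -(mxrankMfree _ (row_base_free U)).
  by rewrite -[_ *m row_base U]/(val_submod _) in_submodK ?(eqnP freeB) ?eqBU.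
- move=> h hH; rewrite [in LHS]in_submodE mulmxA homB // -in_submodE.
  by rewrite (in_submodJ modU) ?eqBU.
Qed.

Lemma is_copy_stable d (sigma : mx_representation F H d) (U : 'M_n) :
  is_copy rG sigma U -> forall h, h \in H -> (U *m rG h <= U)%MS.
Proof.
move=> /is_copyP[_ [B [_ eB hB]]] h hH.
by rewrite -(eqmxMr _ eB) -eB -hB ?submxMl.
Qed.

Lemma is_copy_rsim d (sigma : mx_representation F H d)
    e (tau : mx_representation F H e) (U : 'M_n) :
  is_copy rG sigma U -> is_copy rG tau U -> mx_rsim sigma tau.
Proof.
move=> [sHG [modU simU]] [sHG' [modU' simU']].
rewrite (bool_irrelevance sHG' sHG) in modU' simU' *.
rewrite (bool_irrelevance modU' modU) in simU'.
exact: mx_rsim_trans (mx_rsim_sym simU').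
Qed.

Lemma is_copy_trans d (sigma : mx_representation F H d)
    e (tau : mx_representation F H e) (U : 'M_n) :
  mx_rsim tau sigma -> is_copy rG sigma U -> is_copy rG tau U.
Proof.
by move=> ts [sHG [modU sU]]; exists sHG, modU; apply: mx_rsim_trans sU.
Qed.

Lemma is_copy_simple d (sigma : mx_representation F H d) (U : 'M_n)
    (sHG : H \subset G) :
  mx_irreducible sigma -> is_copy rG sigma U ->
  mxsimple (subg_repr rG sHG) U.
Proof.
move=> irr [sHG' [modU sU]]; rewrite (bool_irrelevance sHG' sHG) in modU sU.
by apply/(submod_mx_irr modU); apply: mx_rsim_irr irr.
Qed.

Lemma simple_is_copy (sHG : H \subset G) (U : 'M_n) :
  mxsimple (subg_repr rG sHG) U ->
  exists d (sigma : mx_representation F H d),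
    mx_irreducible sigma /\ is_copy rG sigma U.
Proof.
move=> simU; have [modU _ _] := simU; exists (\rank U), (submod_repr modU).
by split; [exact/submod_mx_irr | exists sHG, modU; exact: mx_rsim_refl].
Qed.

(** Half of Schur's lemma: the kernel is an invariant subspace. *)
Lemma intertwines_free d (sigma : mx_representation F H d)
    (g : gT -> 'M[F]_n) (B : 'M_(d, n)) :
  mx_irreducible sigma -> intertwines H sigma g B -> B != 0 -> row_free B.
Proof.
move=> /mx_irrP[_ irr] homB; apply: contra_neqT => nfree.
have modK : mxmodule sigma (kermx B).
  apply/mxmoduleP=> h hH; apply/sub_kermxP.
  by rewrite -mulmxA homB // mulmxA mulmx_ker mul0mx.
have := irr _ modK; rewrite kermx_eq0 => /(_ nfree).
by rewrite -sub1mx => /sub_kermxP; rewrite mul1mx.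
Qed.

Lemma is_copy_genmx d (sigma : mx_representation F H d) (B : 'M_(d, n)) :
  H \subset G -> mx_irreducible sigma -> intertwines H sigma rG B -> B != 0 ->
  is_copy rG sigma <<B>>%MS.
Proof.
move=> sHG irr homB nzB; apply/is_copyP; split=> //; exists B; split=> //.
  exact: intertwines_free homB nzB.
exact/eqmx_sym/genmxE.
Qed.

End Copies.

(** For subspaces invariant under the whole group, copies may be compared
    without passing to the restriction of the representation to the full
    subgroup. *)
Lemma is_copy_full (F : fieldType) (gT : finGroupType) (G : {group gT})
    (n d : nat) (rG : mx_representation F G n) (sigma : mx_representation F G d)
    (U : 'M_n) (modU : mxmodule rG U) :
  is_copy rG sigma U <-> mx_rsim sigma (submod_repr modU).
Proof.
split=> [[sGG [modU' [B ed fB hB]]]|[B ed fB hB]].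
  exact: (MxReprSim (B := B)).
by exists (subxx G), modU; apply: (MxReprSim (B := B)).
Qed.

Lemma is_copy_in_submod (F : fieldType) (gT : finGroupType)
    (G H L : {group gT}) (n d : nat) (rG : mx_representation F G n)
    (sLG : L \subset G) (W : 'M_n) (modW : mxmodule (subg_repr rG sLG) W)
    (sigma : mx_representation F H d) (U : 'M_n) :
  H \subset L -> (U <= W)%MS -> is_copy rG sigma U ->
  is_copy (submod_repr modW) sigma <<in_submod W U>>%MS.
Proof.
move=> sHL sUW /is_copyP[_ [B [fB eB hB]]].
have sBW : (B <= W)%MS by rewrite eB.
apply/is_copyP; split=> //; exists (in_submod W B); split.
- rewrite /row_free -(mxrankMfree _ (row_base_free W)).
  by rewrite -[_ *m row_base W]/(val_submod _) in_submodK.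
- apply: eqmx_trans (eqmx_sym (genmxE _)); exact: eqmxMr.
- move=> h hH; rewrite [in LHS]in_submodE mulmxA hB // -in_submodE.
  by rewrite (in_submodJ modW).
Qed.

Lemma intertwines_rsim (F : fieldType) (gT : finGroupType) (H : {group gT})
    d (sigma : mx_representation F H d) e (tau : mx_representation F H e)
    (B : 'M_(d, e)) :
  mx_irreducible sigma -> mx_irreducible tau ->
  intertwines H sigma tau B -> B != 0 -> mx_rsim sigma tau.
Proof.
move=> irrs irrt homB nzB; have freeB := intertwines_free irrs homB nzB.
have cp := is_copy_genmx (subxx H) irrs homB nzB.
have /mx_irrP[_ /(_ <<B>>%MS)] := irrt.
rewrite /row_full genmxE (eqnP freeB) => full.
apply: (MxReprSim (B := B)) => //; apply/eqP/full.
  exact: intertwines_module homB.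
by rewrite -mxrank_eq0 genmxE mxrank_eq0.
Qed.

(** * Uniqueness of copies in a multiplicity-free representation *)

(** A copy of sigma is isomorphic to one summand W i. Its projection to the sum
    of the other summands is an image of sigma, hence zero, since a nonzero
    image would make a second summand isomorphic to sigma. So the copy lies in
    W i, and equals it by simplicity. *)
Lemma is_copy_uniq_mfree (F : fieldType) (gT : finGroupType) (L : {group gT})
    (n d : nat) (theta : mx_representation F L n)
    (sigma : mx_representation F L d) (A B : 'M_n) :
  multiplicity_free theta -> mx_irreducible sigma ->
  is_copy theta sigma A -> is_copy theta sigma B -> (A :=: B)%MS.
Proof.
move=> [I [W [simW noniso dxW sumW]]] irr.
have iso_copies i j : is_copy theta sigma (W i) -> is_copy theta sigma (W j) ->
    mx_iso theta (W i) (W j).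
  have [[modi _ _] [modj _ _]] := (simW i, simW j).
  move=> /(is_copy_full _ modi) simi /(is_copy_full _ modj) simj.
  by apply/(mx_rsim_iso modi modj); apply: mx_rsim_trans (mx_rsim_sym simi) simj.
suff key U : is_copy theta sigma U ->
    exists2 i, (U :=: W i)%MS & is_copy theta sigma (W i).
  move=> /key[i eqA cpi] /key[j eqB cpj].
  have [eij|neij] := eqVneq i j.
    by apply: eqmx_trans eqA _; rewrite eij; exact: eqmx_sym.
  by case: (noniso i j neij); exact: iso_copies cpi cpj.
move=> /is_copyP[_ [B0 [fB eB hB]]].
pose S i := (\sum_(j | j != i) W j)%MS.
have modS i : mxmodule theta (S i).
  by apply: sumsmx_module => j _; case: (simW j).
have capS i : (W i :&: S i = 0)%MS by apply: (mxdirect_sumsP dxW).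
have addS i : (W i + S i :=: 1%:M)%MS.
  by apply: eqmx_trans sumW; rewrite (bigD1 i).
have hom1 j : (W j <= dom_hom_mx theta 1%:M)%MS.
  by apply/hom_mxP=> h hL; rewrite !mulmx1.
(* partial sums are allowed, so that both the whole sum and S i can be used *)
have cpW (P : pred I) (X : 'M_(d, n)) : intertwines L sigma theta X ->
    X != 0 -> (X <= \sum_(j | P j) W j)%MS ->
    exists2 j, P j & is_copy theta sigma (W j).
  move=> homX nzX sXW; have cpX := is_copy_genmx (subxx L) irr homX nzX.
  have simX : mxsimple theta <<X>>%MS by apply: (is_copy_simple (subxx L) irr cpX).
  have [||||j Pj isoj] := @hom_mxsemisimple_iso _ _ _ _ theta I P <<X>>%MS W 1%:M.
  - exact: simX.
  - by move=> j _ _; exact: simW.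
  - by apply/sumsmx_subP=> j _; exact: hom1.
  - by rewrite mulmx1 genmxE.
  exists j => //; have [modj _ _] := simW j; have [modX _ _] := simX.
  apply/(is_copy_full _ modj); move/(is_copy_full _ modX): cpX => simX'.
  by apply: mx_rsim_trans simX' _; apply/(mx_rsim_iso modX modj)/mx_iso_sym.
have nzB : B0 != 0.
  by rewrite -mxrank_eq0 (eqnP fB) -lt0n; have /mx_irrP[] := irr.
have [|i _ cpi] := cpW predT B0 hB nzB; first by rewrite sumW submx1.
exists i => //.
set p := proj_mx (W i) (S i).
have homC : intertwines L sigma theta (B0 - B0 *m p).
  move=> h hL; have [modW _ _] := simW i.
  have : (1%:M <= dom_hom_mx theta p)%MS.
    by rewrite -(addS i); apply: proj_mx_hom.
  move=> /hom_mxP/(_ h hL); rewrite !mul1mx => homp.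
  by rewrite mulmxBr mulmxBl mulmxA hB // -mulmxA homp mulmxA.
have [/eqP|nzC] := eqVneq (B0 - B0 *m p) 0.
  rewrite subr_eq0 => /eqP eB0; have sBW : (B0 <= W i)%MS.
    by rewrite eB0 proj_mx_sub.
  apply: eqmx_trans (eqmx_sym eB) _.
  have [modWi _ minW] := simW i.
  apply/eqmxP; rewrite sBW /= -(genmxE B0) minW ?genmxE //.
    exact: intertwines_module hB.
  by rewrite -mxrank_eq0 genmxE mxrank_eq0.
have [|j ij cpj] := cpW (fun j => j != i) _ homC nzC.
  by apply: proj_mx_compl_sub; rewrite addS submx1.
by case: (noniso j i ij); exact: iso_copies cpj cpi.
Qed.

(** * Orthogonality and unitarity *)

Section Unitary.

Context {C : numClosedFieldType}.

Lemma adjmxM m n p (A : 'M[C]_(m, n)) (B : 'M_(n, p)) :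
  (A *m B)^t* = B^t* *m A^t*.
Proof. by rewrite trmx_mul map_mxM. Qed.

Lemma adjmx0 m n : (0 : 'M[C]_(m, n))^t* = 0.
Proof. by rewrite trmx0 map_mx0. Qed.

Lemma adjmx_mul_eq0 m n (A : 'M[C]_(m, n)) : A *m A^t* = 0 -> A = 0.
Proof.
move=> AA0; apply/row_matrixP=> i; rewrite row0.
have : dotmx (row i A) (row i A) = 0.
  by rewrite dotmxE rowE adjmxM mulmxA -(mulmxA _ A) AA0 mulmx0 mul0mx mxE.
by move/eqP; rewrite dnorm_eq0 => /eqP.
Qed.

Lemma orth_sym m n p (A : 'M[C]_(m, n)) (B : 'M_(p, n)) :
  A *m B^t* = 0 -> B *m A^t* = 0.
Proof. by move=> AB0; rewrite -[B]trmxCK -adjmxM AB0 adjmx0. Qed.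

Lemma orth_sub m n p q k (A : 'M[C]_(m, n)) (B : 'M_(p, n))
    (A' : 'M_(q, n)) (B' : 'M_(k, n)) :
  (A' <= A)%MS -> (B' <= B)%MS -> A *m B^t* = 0 -> A' *m B'^t* = 0.
Proof.
move=> /submxP[D ->] /submxP[E ->] AB0.
by rewrite adjmxM mulmxA -(mulmxA D) AB0 mulmx0 mul0mx.
Qed.

Lemma sumsmx_orth (I : finType) (Q : pred I) n p (A : I -> 'M[C]_n)
    (B : 'M_(p, n)) :
  (forall i, Q i -> A i *m B^t* = 0) -> (\sum_(i | Q i) A i)%MS *m B^t* = 0.
Proof. by move=> AB0; apply/sub_kermxP/sumsmx_subP=> i /AB0/sub_kermxP. Qed.

Lemma orth_direct k (I : finType) (Q : pred I) (A : I -> 'M[C]_k) :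
  (forall i j, Q i -> Q j -> i != j -> A i *m (A j)^t* = 0) ->
  mxdirect (\sum_(i | Q i) A i).
Proof.
move=> orthA; apply/mxdirect_sumsP=> i Qi; apply/eqP/rowV0P=> v.
rewrite sub_capmx => /andP[vi vS]; apply: adjmx_mul_eq0.
apply: orth_sub vi vS _; apply: orth_sym; apply: sumsmx_orth => j /andP[Qj nji].
exact: orthA.
Qed.

Lemma gram_unit m n (A : 'M[C]_(m, n)) : row_free A -> A *m A^t* \in unitmx.
Proof.
move=> freeA; rewrite -row_free_unit; apply: inj_row_free => v vAA0.
have: v *m A = 0.
  by apply: adjmx_mul_eq0; rewrite adjmxM !mulmxA -(mulmxA v) vAA0 mul0mx.
by rewrite -(mul0mx _ A) => /(row_free_inj freeA).
Qed.

Context {gT : finGroupType} {H : {group gT}}.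

Lemma num_group_char (K : {group gT}) : ([pchar C]^').-group%g K.
Proof.
apply/pgroupP=> p _ _; rewrite !inE.
by have := pchar_num C p; rewrite !inE => ->.
Qed.

Lemma num_semisimple n (rH : mx_representation C H n) (U : 'M_n) :
  mxmodule rH U -> mxsemisimple rH U.
Proof.
move=> modU; apply: dec_mx_reducible_semisimple => //.
apply: mx_reducibleS (submx1 U) _ => //.
exact/mx_Maschke_pchar/num_group_char.
Qed.

(** The Gram matrix M = B B^* need not be scalar, as tau is not assumed unitary,
    but it intertwines tau with its conjugate dual. Hence A B^* M^-1 intertwines
    sigma and tau and vanishes by Schur's lemma. *)
Lemma intertwines_orth d (sigma : mx_representation C H d)
    e (tau : mx_representation C H e) n (r : gT -> 'M[C]_n)
    (A : 'M_(d, n)) (B : 'M_(e, n)) :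
  (forall h, h \in H -> r h^-1%g = (r h)^t*) ->
  mx_irreducible sigma -> mx_irreducible tau -> ~ mx_rsim sigma tau ->
  intertwines H sigma r A -> intertwines H tau r B -> A *m B^t* = 0.
Proof.
move=> adjr irrs irrt nsim homA homB.
have [->|nzB] := eqVneq B 0; first by rewrite adjmx0 mulmx0.
have uM := gram_unit (intertwines_free irrt homB nzB).
set M := B *m B^t* in uM.
have homBa h : h \in H -> (r h) *m B^t* = B^t* *m (tau h^-1%g)^t*.
  move=> hH; rewrite -adjmxM homB ?groupV // adjmxM adjr //.
  by rewrite trmxCK.
have homM h : h \in H -> (tau h^-1%g)^t* *m invmx M = invmx M *m tau h.
  move=> hH; apply: (canRL (mulKmx uM)).
  rewrite mulmxA -(mulmxA B) -homBa // mulmxA -homB // -mulmxA.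
  by rewrite mulmxK.
have homC : intertwines H sigma tau (A *m B^t* *m invmx M).
  move=> h hH; rewrite !mulmxA homA // -!mulmxA -homM //; congr (_ *m _).
  by rewrite !mulmxA homBa.
have [C0|nzC] := eqVneq (A *m B^t* *m invmx M) 0.
  by rewrite -(mulmxKV uM (A *m B^t* )) C0 mul0mx.
by case: nsim; exact: intertwines_rsim homC nzC.
Qed.

End Unitary.

(** * Induction inside a representation with a system of imprimitivity *)

Section LcosetRepr.

Context {gT : finGroupType} {H L : {group gT}}.
Hypothesis sHL : H \subset L.

Lemma repr_lcoset_mem (A : {set gT}) : A \in lcosets H L -> repr A \in A.
Proof. by case/lcosetsP=> x _ ->; exact: mem_repr (lcoset_refl _ _). Qed.

Lemma repr_lcoset_sub (A : {set gT}) : A \in lcosets H L -> repr A \in L.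
Proof.
move=> AHL; have := repr_lcoset_mem AHL; case/lcosetsP: AHL => x xL ->.
by case/lcosetP=> h hH ->; rewrite groupM // (subsetP sHL).
Qed.

Lemma repr_lcosetE (A : {set gT}) : A \in lcosets H L -> A = (repr A *: H)%g.
Proof.
move=> AHL; have := repr_lcoset_mem AHL; case/lcosetsP: AHL => x xL ->.
by move/lcoset_eqP->.
Qed.

Lemma repr_lcoset_inj (A B : {set gT}) :
  A \in lcosets H L -> B \in lcosets H L ->
  ((repr A)^-1 * repr B \in H)%g = (A == B).
Proof.
move=> AHL BHL; rewrite [in RHS](repr_lcosetE AHL) [in RHS](repr_lcosetE BHL).
by rewrite -mem_lcoset eq_sym; apply/lcoset_eqP/eqP.
Qed.

Lemma lcoset_mem_lcosets (g : gT) : g \in L -> (g *: H)%g \in lcosets H L.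
Proof. by move=> gL; apply/lcosetsP; exists g. Qed.

End LcosetRepr.

(** P is to be thought of as the restriction of functions to the base block of
    a partition permuted by L, H being the stabilizer of that block; U *m P = U
    then says that U is supported on the block. *)
Section Imprimitivity.

Context {C : numClosedFieldType} {gT : finGroupType} {G H L : {group gT}}.
Context {n : nat} {rG : mx_representation C G n} {P : 'M[C]_n}.
Hypotheses (sHL : H \subset L) (sLG : L \subset G).
Hypothesis PC : forall h, h \in H -> P *m rG h = rG h *m P.
Hypothesis P0 : forall g, g \in L -> g \notin H -> P *m rG g *m P = 0.

Let sHG := subset_trans sHL sLG.
Local Notation ind := (ind_space rG H L).

Let rM g h : g \in L -> h \in L -> rG g *m rG h = rG (g * h)%g.
Proof. by move=> gL hL; rewrite repr_mxM // (subsetP sLG). Qed.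

Lemma sub_indP m (U : 'M[C]_n) (X : 'M_(m, n)) :
  reflect (exists x : {set gT} -> 'M[C]_(m, n),
            X = \sum_(A in lcosets H L) x A *m U *m rG (repr A)^-1%g)
          (X <= ind U)%MS.
Proof.
apply: (iffP sub_sumsmxP) => -[x ->]; exists x; apply: eq_bigr => A _.
  by rewrite /lact mulmxA.
by rewrite /lact mulmxA.
Qed.

(** Moving the translate indexed by B back to the base block and applying P
    kills all other translates, so P separates the summands of Ind U. *)
Lemma ind_component m (U : 'M[C]_n) (x : {set gT} -> 'M[C]_(m, n)) B :
  U *m P = U -> B \in lcosets H L ->
  (\sum_(A in lcosets H L) x A *m U *m rG (repr A)^-1%g) *m rG (repr B) *m P
    = x B *m U.
Proof.
move=> UP BHL; rewrite !mulmx_suml (bigD1 B) //= big1 ?addr0 => [|A /andP[AHL nAB]].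
  rewrite -(mulmxA (x B *m U)) rM ?groupV ?(repr_lcoset_sub sHL) //.
  by rewrite mulVg repr_mx1 mulmx1 -mulmxA UP.
rewrite -(mulmxA (x A *m U)) rM ?groupV ?(repr_lcoset_sub sHL) //.
rewrite -{1}UP -!mulmxA [P *m (_ *m _)]mulmxA P0 ?mulmx0 //.
  by rewrite groupM ?groupV ?(repr_lcoset_sub sHL).
by rewrite (repr_lcoset_inj AHL BHL).
Qed.

Lemma sub_ind (U : 'M[C]_n) g :
  (forall h, h \in H -> (U *m rG h <= U)%MS) -> g \in L ->
  (U *m rG g <= ind U)%MS.
Proof.
move=> modU gL; set B := (g^-1 *: H)%g.
have BHL : B \in lcosets H L by apply: lcoset_mem_lcosets; rewrite groupV.
have hH : (g * repr B)%g \in H.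
  by have := repr_lcoset_mem BHL; rewrite mem_lcoset invgK.
rewrite (sumsmx_sup B) // /lact.
have bL := repr_lcoset_sub sHL BHL.
rewrite -{1}(mulgK (repr B) g) -rM ?groupM ?groupV // mulmxA.
exact: submxMr (modU _ hH).
Qed.

Lemma ind_stable (U : 'M[C]_n) :
  (forall h, h \in H -> (U *m rG h <= U)%MS) ->
  forall g, g \in L -> (ind U *m rG g <= ind U)%MS.
Proof.
move=> modU g gL; rewrite /ind_space sumsmxMr.
apply/sumsmx_subP=> A AHL; rewrite /lact -mulmxA.
rewrite rM ?groupV ?(repr_lcoset_sub sHL) //.
by rewrite sub_ind // groupM ?groupV ?(repr_lcoset_sub sHL).
Qed.

(** A function vanishing on the base block together with all its translates
    vanishes on every block. *)
Lemma ind_restr_eq0 m (U : 'M[C]_n) (X : 'M_(m, n)) :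
  U *m P = U -> (X <= ind U)%MS ->
  (forall g, g \in L -> (X *m rG g <= X)%MS) -> X *m P = 0 -> X = 0.
Proof.
move=> UP /sub_indP[x eX] modX XP0.
rewrite eX big1 // => B BHL; rewrite -(ind_component x UP BHL) -eX.
have [D ->] := submxP (modX _ (repr_lcoset_sub sHL BHL)).
by rewrite -(mulmxA D) XP0 mulmx0 mul0mx.
Qed.

(** The base coset H enters with the representative repr H, which may differ
    from 1; this is compensated by the H-invariance of U. *)
Lemma ind_restr_sub m (U : 'M[C]_n) (X : 'M_(m, n)) :
  U *m P = U -> (forall h, h \in H -> (U *m rG h <= U)%MS) ->
  (X <= ind U)%MS -> (X *m P <= U)%MS.
Proof.
move=> UP modU sX.
have HHL : (H : {set gT}) \in lcosets H L.
  by rewrite -[in X in X \in _](lcoset1 H); apply: lcoset_mem_lcosets.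
have rH : repr H \in H := repr_lcoset_mem HHL.
case/sub_indP: sX => x eX.
have: (X *m rG (repr H) *m P <= U)%MS.
  by rewrite eX (ind_component x UP HHL) submxMl.
rewrite -mulmxA -PC // mulmxA => /(submxMr (rG (repr H)^-1%g)).
rewrite -mulmxA rM ?groupV ?(subsetP sHL _ rH) // mulgV repr_mx1 mulmx1.
by move/submx_trans; apply; apply: modU; rewrite groupV.
Qed.

(** With Q the projection onto a block of a coarser partition, this keeps track
    of supports under induction. *)
Lemma ind_fix m (U Q : 'M[C]_n) (X : 'M_(m, n)) :
  U *m Q = U -> (forall g, g \in L -> Q *m rG g = rG g *m Q) ->
  (X <= ind U)%MS -> X *m Q = X.
Proof.
move=> UQ QC /sub_indP[x ->]; rewrite mulmx_suml; apply: eq_bigr => A AHL.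
rewrite -(mulmxA (x A *m U)) -QC ?groupV ?(repr_lcoset_sub sHL) //.
by rewrite mulmxA -(mulmxA (x A)) UQ.
Qed.

Lemma ind_orth (U V : 'M[C]_n) :
  (forall g, g \in L -> rG g^-1%g = (rG g)^t*) -> P^t* = P ->
  U *m P = U -> V *m P = V -> U *m V^t* = 0 -> ind U *m (ind V)^t* = 0.
Proof.
move=> adjr Pa UP VP UV0; apply: sumsmx_orth => A AHL.
apply: orth_sym; apply: sumsmx_orth => B BHL; apply: orth_sym.
have aL := repr_lcoset_sub sHL AHL; have bL := repr_lcoset_sub sHL BHL.
rewrite /lact adjmxM -adjr ?groupV // invgK.
rewrite mulmxA -(mulmxA U) rM ?groupV //.
have [eAB|nAB] := eqVneq A B.
  by rewrite eAB mulVg repr_mx1 mulmx1.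
rewrite -VP -{1}UP adjmxM Pa !mulmxA -(mulmxA U) -(mulmxA U) P0 ?mulmx0 ?mul0mx //.
  by rewrite groupM ?groupV.
by rewrite (repr_lcoset_inj AHL BHL).
Qed.

End Imprimitivity.

(** * Frobenius reciprocity for induced subspaces *)

Section Frobenius.

Context {C : numClosedFieldType} {gT : finGroupType} {G H L : {group gT}}.
Context {n : nat} {rG : mx_representation C G n} {P : 'M[C]_n}.
Hypotheses (sHL : H \subset L) (sLG : L \subset G).
Hypothesis PC : forall h, h \in H -> P *m rG h = rG h *m P.
Hypothesis P0 : forall g, g \in L -> g \notin H -> P *m rG g *m P = 0.
Local Notation ind := (ind_space rG H L).

Context {d : nat} {sigma : mx_representation C H d} {U : 'M[C]_n}.
Hypotheses (cpU : is_copy rG sigma U) (UP : U *m P = U).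

Let stU := is_copy_stable cpU.

Lemma ind_module : mxmodule (subg_repr rG sLG) (ind U).
Proof. by apply/mxmoduleP=> g gL; apply: ind_stable. Qed.

(** This turns the subspace Ind U of rG into a representation of L in its own
    coordinates, to which the Gelfand-Tsetlin condition applies. *)
Lemma ind_induced : is_induced sigma (submod_repr ind_module).
Proof.
pose V := <<in_submod (ind U) U>>%MS.
have sU g : g \in L -> (U *m rG g <= ind U)%MS by apply: sub_ind.
have sUI : (U <= ind U)%MS.
  by rewrite -[X in (X <= _)%MS]mulmx1 -(repr_mx1 rG) sU.
have eqV A : A \in lcosets H L ->
    (lact (submod_repr ind_module) (repr A) V
       :=: in_submod (ind U) (lact rG (repr A) U))%MS.
  move=> AHL; rewrite /lact; apply: eqmx_trans (eqmxMr _ (genmxE _)) _.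
  by rewrite (in_submodJ ind_module).
exists V; split; first exact: is_copy_in_submod.
- apply/mxdirect_sumsP=> A AHL; apply/eqP/rowV0P=> v.
  rewrite sub_capmx eqV // => /andP[].
  rewrite -val_submodS in_submodK; last first.
    by rewrite /lact sU // groupV (repr_lcoset_sub sHL).
  rewrite /lact => /submxP[D eD] sv.
  apply/eqP; rewrite -val_submod_eq0 eD; apply/eqP.
  have : (val_submod v <= \sum_(B in lcosets H L | B != A)
            lact rG (repr B) U)%MS.
    have /sub_sumsmxP[u eu] := sv; rewrite eu linear_sum summx_sub // => B BnA.
    have [BHL _] := andP BnA; rewrite (sumsmx_sup B) //.
    apply: submx_trans (_ : val_submod (lact (submod_repr ind_module) (repr B) V) <= _)%MS.
      by rewrite val_submodS submxMl.
    apply: submx_trans (_ : (val_submod (in_submod (ind U) (lact rG (repr B) U)) <= _)%MS).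
      by rewrite val_submodS eqV.
    by rewrite in_submodK // /lact sU // groupV (repr_lcoset_sub sHL).
  case/sub_sumsmxP=> u eu.
  (* the relation between one translate and the others, as a vanishing sum *)
  pose x B := if B == A then - D else u B.
  have x0 : \sum_(B in lcosets H L) x B *m U *m rG (repr B)^-1%g = 0.
    rewrite (bigD1 A) //= {1}/x eqxx !mulNmx -mulmxA -eD eu.
    apply/eqP; rewrite addrC subr_eq0; apply/eqP; apply: eq_bigr => B /andP[_ nBA].
    by rewrite /x (negPf nBA) mulmxA.
  have := ind_component sHL sLG P0 x UP AHL.
  rewrite x0 !mul0mx /x eqxx mulNmx => /esym/eqP; rewrite oppr_eq0 => /eqP DU0.
  by rewrite mulmxA DU0 mul0mx.
- apply/eqmxP; rewrite submx1 /=.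
  rewrite -val_submodS val_submod1.
  apply/sumsmx_subP=> A AHL.
  rewrite -(@in_submodK _ _ (ind U) _ (lact rG (repr A) U)); last first.
    by rewrite /lact sU // groupV (repr_lcoset_sub sHL).
  by rewrite val_submodS -eqV // /ind_space (sumsmx_sup A).
Qed.

Lemma ind_copy_uniq e (tau : mx_representation C L e) (A B : 'M_n) :
  (forall k (theta : mx_representation C L k),
      is_induced sigma theta -> multiplicity_free theta) ->
  mx_irreducible tau -> is_copy rG tau A -> is_copy rG tau B ->
  (A <= ind U)%MS -> (B <= ind U)%MS -> (A :=: B)%MS.
Proof.
move=> mfree irrt cpA cpB sA sB.
have eqAB := is_copy_uniq_mfree (mfree _ _ ind_induced) irrt
  (is_copy_in_submod ind_module (subxx L) sA cpA)
  (is_copy_in_submod ind_module (subxx L) sB cpB).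
have eq' : (in_submod (ind U) A :=: in_submod (ind U) B)%MS.
  apply: eqmx_trans (eqmx_sym (genmxE _)) _; apply: eqmx_trans eqAB _.
  exact: genmxE.
apply/eqmxP.
by rewrite -(in_submodK sA) -(in_submodK sB) !val_submodS !eq' submx_refl.
Qed.

Let card_neq0 : (#|H|%:R : C) != 0.
Proof. by rewrite pnatr_eq0 -lt0n cardG_gt0. Qed.

(** With BM embedding sigma in tau, V a matrix with BM V = 1 and BU the
    embedding of sigma onto U, averaging V BU over L gives an intertwiner T
    from tau into Ind U. It is nonzero because on the image of BM, and after
    projection by P, only the elements of H contribute, each of them giving
    BU. *)
Lemma ind_copy_exists e (tau : mx_representation C L e) :
  mx_irreducible sigma -> mx_irreducible tau ->
  (exists M, is_copy tau sigma M) ->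
  exists2 A, (A <= ind U)%MS & is_copy rG tau A.
Proof.
move=> irrs irrt [M /is_copyP[_ [BM [fM _ hM]]]].
have /is_copyP[_ [BU [fU eU hU]]] := cpU.
have BUP : BU *m P = BU.
  by have /submxP[D ->] : (BU <= U)%MS; rewrite ?eU // -mulmxA UP.
have LG g : g \in L -> g \in G by apply: (subsetP sLG).
have HL g : g \in H -> g \in L by apply: (subsetP sHL).
have [V BMV] : exists V, BM *m V = 1%:M by exists (pinvmx BM); apply: mulmxVp.
pose T := \sum_(g in L) tau g *m (V *m BU) *m rG g^-1%g.
have homT : intertwines L tau rG T.
  move=> h hL; rewrite mulmx_sumr mulmx_suml.
  rewrite [RHS](reindex_inj (mulgI h)) /=; apply: eq_big => g.
    by rewrite groupMl.
  move=> gL; rewrite repr_mxM // invMg repr_mxM ?groupV ?LG //.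
  rewrite -!mulmxA -repr_mxM ?groupV ?LG // mulVg repr_mx1 mulmx1.
  by [].
have TP : BM *m T *m P = #|H|%:R *: BU.
  rewrite mulmx_sumr mulmx_suml (bigID (mem H)) /= [X in _ + X]big1; last first.
    move=> g /andP[gL ngH].
    rewrite -BUP -!mulmxA [P *m (_ *m _)]mulmxA P0 ?mulmx0 ?groupV //.
  rewrite addr0 (eq_bigl (mem H)); last first.
    by move=> g /=; case: (boolP (g \in H)) => [/HL->|]; rewrite ?andbF.
  rewrite (eq_bigr (fun=> BU)) ?sumr_const ?scaler_nat // => g gH.
  rewrite -!mulmxA -PC ?groupV // [BU *m _]mulmxA BUP -hU ?groupV //.
  rewrite !mulmxA -hM // -(mulmxA (sigma g)) BMV mulmx1.
  by rewrite -repr_mxM ?groupV // mulgV repr_mx1 mul1mx.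
exists <<T>>%MS.
  rewrite genmxE summx_sub // => g gL.
  apply: submx_trans (_ : (U *m rG g^-1%g <= _)%MS).
    by rewrite submxMr // -eU mulmxA submxMl.
  by rewrite sub_ind ?groupV.
apply: is_copy_genmx => //; apply/eqP=> T0.
move: TP; rewrite T0 mulmx0 mul0mx => /esym/eqP.
rewrite scaler_eq0 (negPf card_neq0) /= -mxrank_eq0 (eqnP fU) => /eqP d0.
by have /mx_irrP[+ _] := irrs; rewrite d0.
Qed.

(** Restriction to the base block maps the copy A of tau into U without
    vanishing on it, hence gives a surjective H-map X from tau to sigma;
    averaging a section of X over H embeds sigma in tau. *)
Lemma ind_copy_edge e (tau : mx_representation C L e) (A : 'M_n) :
  mx_irreducible sigma -> mx_irreducible tau ->
  is_copy rG tau A -> (A <= ind U)%MS -> exists M, is_copy tau sigma M.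
Proof.
move=> irrs irrt cpA sA.
have /is_copyP[_ [BA [fA eA hA]]] := cpA.
have /is_copyP[_ [BU [fU eU hU]]] := cpU.
have HL g : g \in H -> g \in L by apply: (subsetP sHL).
have sBA : (BA <= ind U)%MS by rewrite eA.
have /submxP[X eX] : (BA *m P <= BU)%MS.
  by rewrite eU (ind_restr_sub sHL sLG PC P0).
have nzX : X != 0.
  apply: contraTneq fA => X0.
  rewrite (@ind_restr_eq0 _ _ _ _ _ _ _ _ sHL sLG P0 _ _ BA UP) //.
  - rewrite /row_free mxrank0 eq_sym -lt0n; by have /mx_irrP[] := irrt.
  - by move=> g gL; rewrite -hA // submxMl.
  - by rewrite eX X0 mul0mx.
have homX : intertwines H tau sigma X.
  move=> h hH; apply: (row_free_inj fU).
  by rewrite -!mulmxA -eX hU // (mulmxA X) -eX -!mulmxA PC // !mulmxA hA // HL.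
have fullX : row_full X.
  have /mx_irrP[_ /(_ <<X>>%MS)] := irrs; rewrite /row_full genmxE; apply.
    exact: intertwines_module homX.
  by rewrite -mxrank_eq0 genmxE mxrank_eq0.
have [V VX] : exists V, V *m X = 1%:M by exists (pinvmx X); apply: mulVpmx.
pose Y := \sum_(h in H) sigma h *m V *m tau h^-1%g.
have homY : intertwines H sigma tau Y.
  move=> h hH; rewrite mulmx_sumr mulmx_suml.
  rewrite [RHS](reindex_inj (mulgI h)) /=; apply: eq_big => g.
    by rewrite groupMl.
  move=> gH; rewrite repr_mxM // invMg repr_mxM ?groupV ?HL //.
  by rewrite -!mulmxA -repr_mxM ?groupV ?HL // mulVg repr_mx1 mulmx1.
have YX : Y *m X = #|H|%:R *: 1%:M.
  rewrite mulmx_suml (eq_bigr (fun=> 1%:M)) ?sumr_const ?scaler_nat // => h hH.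
  rewrite -mulmxA homX ?groupV // !mulmxA -(mulmxA _ V) VX mulmx1.
  by rewrite -repr_mxM ?groupV // mulgV repr_mx1.
exists <<Y>>%MS; apply: is_copy_genmx => //; apply/eqP=> Y0.
move: YX; rewrite Y0 mul0mx => /esym/eqP.
rewrite scaler_eq0 (negPf card_neq0) /= -mxrank_eq0 mxrank1 => /eqP d0.
by have /mx_irrP[+ _] := irrs; rewrite d0.
Qed.

End Frobenius.

(** * Irreducible representations of K with invariant vectors *)

Section TrivialReps.

Context {F : fieldType} {gT : finGroupType} {K : {group gT}}.

(** The invariants form a nonzero invariant subspace, so everything is
    invariant; then every line is an invariant subspace. *)
Lemma irr_invariants_trivial d (sigma : mx_representation F K d) :
  mx_irreducible sigma -> has_invariants K sigma ->
  d = 1%N /\ forall k, k \in K -> sigma k = 1%:M.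
Proof.
move=> /mx_irrP[d_gt0 irr] inv.
have triv k : k \in K -> sigma k = 1%:M.
  move=> kK; have := irr _ (rfix_mx_module sigma) inv.
  by rewrite -sub1mx => /rfix_mxP/(_ k kK); rewrite mul1mx.
split=> //; apply/eqP; rewrite eqn_leq d_gt0 andbT.
pose e : 'rV[F]_d := delta_mx 0 (Ordinal d_gt0).
have rke : \rank <<e>>%MS = 1%N by rewrite genmxE mxrank_delta.
have := irr <<e>>%MS; rewrite -mxrank_eq0 /row_full rke => /(_ _ isT)/eqP<- //.
by apply/mxmoduleP=> k kK; rewrite triv ?mulmx1.
Qed.

Lemma irr_invariants_rsim d (sigma : mx_representation F K d)
    e (tau : mx_representation F K e) :
  mx_irreducible sigma -> has_invariants K sigma ->
  mx_irreducible tau -> has_invariants K tau -> mx_rsim sigma tau.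
Proof.
move=> irrs invs irrt invt.
have [d1 trs] := irr_invariants_trivial irrs invs.
have [e1 trt] := irr_invariants_trivial irrt invt.
subst d; subst e; apply: (MxReprSim (B := 1%:M)) => // [|k kK].
  by rewrite row_free_unit unitmx1.
by rewrite trs ?trt.
Qed.

End TrivialReps.

(** * Restriction of functions on G/K to subsets *)

Section PermutationRepresentation.

Context {C : numClosedFieldType} {gT : finGroupType} {G K : {group gT}}.
Hypothesis sKG : K \subset G.
Local Notation N := #|lcosets K G|.
Local Notation R := (LX_repr C G K).

(** Points of X are cosets of K, so for K <= A <= G the points contained in A
    are those of A/K. *)
Definition supp_mx (S : {set gT}) : 'M[C]_N :=
  diag_mx (\row_(i < N) (enum_val i \subset S)%:R).

Lemma point_repr (i : 'I_N) :
  exists2 x, x \in G & enum_val i = (x *: K)%g :> {set gT}.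
Proof. by have /lcosetsP := enum_valP i. Qed.

Lemma point_sub (i : 'I_N) (A : {group gT}) x :
  K \subset A -> x \in (enum_val i : {set gT}) ->
  (enum_val i \subset (A : {set gT})) = (x \in A).
Proof.
move=> sKA; have [y _ ->] := point_repr i; move=> xyK.
rewrite -(lcoset_eqP xyK); apply/subsetP/idP => [->//|xA z].
  exact: lcoset_refl.
by case/lcosetP=> k kK ->; rewrite groupM // (subsetP sKA).
Qed.

Lemma repr_point (i : 'I_N) : repr (enum_val i) \in (enum_val i : {set gT}).
Proof. by have [y _ ->] := point_repr i; apply: mem_repr (lcoset_refl _ _). Qed.

Lemma supp_mxM S S' : supp_mx S *m supp_mx S' = supp_mx (S :&: S').
Proof.
rewrite /supp_mx mulmx_diag; congr diag_mx; apply/rowP=> i; rewrite !mxE.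
by rewrite subsetI -natrM mulnb.
Qed.

Lemma supp_mxJ S g : supp_mx S *m R g = R g *m supp_mx (g^-1 *: S)%g.
Proof.
apply/matrixP=> i j; rewrite mul_diag_mx mul_mx_diag !mxE mulrC.
case: (enum_val i =P _) => [->|_]; last by rewrite !mul0r.
by rewrite !mul1r -{1}(lcosetKV g S) lcosetS.
Qed.

Lemma supp_mx0 : supp_mx set0 = 0.
Proof.
apply/matrixP=> i j; rewrite !mxE.
have -> : enum_val i \subset (set0 : {set gT}) = false.
  by apply/negP=> /subsetP/(_ _ (repr_point i)); rewrite inE.
by rewrite mul0rn.
Qed.

Lemma supp_mx_adj S : (supp_mx S)^t* = supp_mx S.
Proof.
rewrite /supp_mx tr_diag_mx map_diag_mx; congr diag_mx.
by apply/rowP=> i; rewrite !mxE rmorph_nat.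
Qed.

Lemma LX_adj g : g \in G -> R g^-1%g = (R g)^t*.
Proof.
move=> gG; apply/matrixP=> i j; rewrite !mxE rmorph_nat; congr (_%:R).
congr nat_of_bool; apply/eqP/eqP=> ->; rewrite -lcosetM ?mulgV ?mulVg.
  exact/esym/mul1g.
exact/esym/mul1g.
Qed.

Lemma supp_mxC (A : {group gT}) g :
  g \in A -> supp_mx A *m R g = R g *m supp_mx A.
Proof. by move=> gA; rewrite supp_mxJ lcoset_id ?groupV. Qed.

Lemma supp_mxK (A : {group gT}) : supp_mx A *m supp_mx A = supp_mx A.
Proof. by rewrite supp_mxM setIid. Qed.

Lemma supp_mx_disj (A : {group gT}) g :
  g \notin A -> supp_mx A *m R g *m supp_mx A = 0.
Proof.
move=> ngA; rewrite supp_mxJ -mulmxA supp_mxM.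
suff -> : (g^-1 *: A)%g :&: A = finset.set0 by rewrite supp_mx0 mulmx0.
apply/setP=> x; rewrite !inE mem_lcoset invgK; apply/andP=> -[gxA xA].
by case/negP: ngA; rewrite -(mulgK x g) groupM ?groupV.
Qed.

Lemma supp_mxG : supp_mx G = 1%:M.
Proof.
rewrite -[RHS]diag_const_mx; congr diag_mx; apply/rowP=> i; rewrite !mxE.
rewrite (point_sub _ (repr_point i)) //.
by have := repr_point i; have [y yG ->] := point_repr i; case/lcosetP=> k kK ->;
   rewrite groupM // (subsetP sKG).
Qed.

(** L/K is the disjoint union of the subsets A/K, for A a coset of H in L, and
    each of them is a translate of H/K. *)
Lemma supp_mx_lcosets (H L : {group gT}) :
  K \subset H -> H \subset L -> L \subset G ->
  supp_mx L = \sum_(A in lcosets H L) R (repr A) *m supp_mx H *m R (repr A)^-1%g.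
Proof.
move=> sKH sHL sLG; have sKL := subset_trans sKH sHL.
transitivity (\sum_(A in lcosets H L) supp_mx A); last first.
  apply: eq_bigr => A AHL; have aG := subsetP sLG _ (repr_lcoset_sub sHL AHL).
  have -> : supp_mx H = supp_mx ((repr A)^-1 *: A)%g.
    congr supp_mx; apply: (canRL (lcosetK _)).
    exact/esym/(repr_lcosetE AHL).
  by rewrite -supp_mxJ -mulmxA -repr_mxM ?groupV // mulgV repr_mx1 mulmx1.
rewrite /supp_mx -linear_sum; congr diag_mx; apply/rowP=> i.
rewrite summxE mxE.
transitivity (\sum_(A in lcosets H L)
                ((repr (enum_val i) \in (A : {set gT}))%:R : C)); last first.
  apply: eq_bigr => A AHL; rewrite mxE; congr (nat_of_bool _)%:R.
  apply/idP/idP=> [|/subsetP->//]; last exact: repr_point.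
  have := repr_point i; have [y yG ->] := point_repr i => /lcoset_eqP {2}<-.
  case/lcosetsP: AHL => z zL -> /lcoset_eqP<-; exact: mulgS.
set x := repr _; rewrite (point_sub sKL (repr_point i)) -/x.
have [xL|nxL] := boolP (x \in L).
  rewrite (bigD1 (x *: H)%g) ?lcoset_mem_lcosets //= lcoset_refl big1 ?addr0 //.
  move=> A /andP[AHL nA]; case: (boolP (x \in A)) nA => // xA.
  by case/lcosetsP: AHL xA => z _ -> /lcoset_eqP->; rewrite eqxx.
rewrite big1 // => A AHL; case: (boolP (x \in A)) nxL => // xA.
case/lcosetsP: AHL xA => z zL -> /lcosetP[h hH ->].
by rewrite groupM // (subsetP sHL).
Qed.

Lemma supp_mx_sub (H L : {group gT}) :
  K \subset H -> H \subset L -> L \subset G ->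
  (supp_mx L <= ind_space R H L (supp_mx H))%MS.
Proof.
move=> sKH sHL sLG; rewrite (supp_mx_lcosets sKH sHL sLG).
apply: summx_sub => A AHL; rewrite (sumsmx_sup A) //.
by rewrite /lact -mulmxA submxMl.
Qed.

Lemma point_base (i : 'I_N) :
  (enum_val i \subset (K : {set gT})) = (enum_val i == K :> {set gT}).
Proof.
apply/idP/eqP=> [sK|->//]; have [x _ ex] := point_repr i.
rewrite ex lcoset_id //; apply: (subsetP sK); rewrite ex; exact: lcoset_refl.
Qed.

Lemma supp_mx_base k : k \in K -> supp_mx K *m R k = supp_mx K.
Proof.
move=> kK; rewrite supp_mxC //; apply/matrixP=> i j.
rewrite mul_mx_diag !mxE !point_base; case: (enum_val j =P _) => [ej|nej].
  have -> : (k *: enum_val j)%g = enum_val j :> {set gT} by rewrite ej lcoset_id.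
  rewrite (inj_eq enum_val_inj) mulr1; have [->|//] := eqVneq i j.
  by rewrite (introT eqP ej).
rewrite mulr0; have [->|_] := eqVneq i j; last exact/esym/mulr0n.
by rewrite (introF eqP nej).
Qed.

Lemma base_point_uniq (i j : 'I_N) :
  enum_val i = K :> {set gT} -> (enum_val j == K :> {set gT}) = (j == i).
Proof.
by move=> ei; apply/eqP/eqP=> [ej|->//]; apply: enum_val_inj; rewrite ej ei.
Qed.

Lemma LKK_supp : (LKK C G K :=: supp_mx K)%MS.
Proof.
have KX : (K : {set gT}) \in lcosets K G.
  by rewrite -[in X in X \in _](lcoset1 K); apply: lcoset_mem_lcosets.
pose k0 := enum_rank_in KX (K : {set gT}).
have ek0 : enum_val k0 = K :> {set gT} by rewrite enum_rankK_in.
apply: eqmx_trans (genmxE _) _; apply/eqmxP; apply/andP; split.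
  suff -> : (\row_(i < N) (enum_val i == K :> {set gT})%:R : 'rV[C]_N)
            = row k0 (supp_mx K) by apply: row_sub.
  apply/rowP=> i; rewrite !mxE point_base ek0 eqxx (base_point_uniq _ ek0).
  by rewrite eq_sym.
apply/row_subP=> i; case: (boolP (enum_val i == K :> {set gT})) => ei; last first.
  suff -> : row i (supp_mx K) = 0 by apply: sub0mx.
  by apply/rowP=> j; rewrite !mxE point_base (negPf ei) mul0rn.
apply: eq_row_sub (0 : 'I_1) _; apply/rowP=> j; rewrite !mxE point_base ei.
by rewrite (base_point_uniq _ (eqP ei)) eq_sym.
Qed.

Lemma LKK_copy d (sigma : mx_representation C K d) :
  mx_irreducible sigma -> has_invariants K sigma ->
  is_copy R sigma (LKK C G K).
Proof.
move=> irr inv; have [d1 triv] := irr_invariants_trivial irr inv; subst d.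
apply/is_copyP; split=> //.
exists (\row_(i < N) (enum_val i == K :> {set gT})%:R); split.
- rewrite /row_free eqn_leq rank_leq_row lt0n mxrank_eq0.
  have KX : (K : {set gT}) \in lcosets K G.
    by rewrite -[in X in X \in _](lcoset1 K); apply: lcoset_mem_lcosets.
  apply/eqP=> /rowP/(_ (enum_rank_in KX (K : {set gT}))).
  by rewrite !mxE enum_rankK_in // eqxx; apply/eqP; rewrite oner_eq0.
- exact/eqmx_sym/genmxE.
move=> k kK; rewrite triv // mul1mx; set b := \row_(_ < _) _.
have : (b <= supp_mx K)%MS by rewrite -LKK_supp genmxE.
by case/submxP=> D ->; rewrite -mulmxA supp_mx_base.
Qed.

(** Evaluation at the base point is nonzero on a nonzero invariant subspace of
    L(L/K), as L is transitive on L/K; it is unchanged by averaging over K, so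
    the average of a function that it does not kill is a nonzero invariant. *)
Lemma copy_has_invariants (L : {group gT}) d (tau : mx_representation C L d)
    (A : 'M_N) :
  K \subset L -> L \subset G -> mx_irreducible tau -> is_copy R tau A ->
  A *m supp_mx L = A -> has_invariants K tau.
Proof.
move=> sKL sLG irr /is_copyP[_ [B [fB eB hB]]] AL.
have nzBP : B *m supp_mx K != 0.
  apply: contraTneq fB => BP0.
  suff -> : B = 0.
    by rewrite /row_free mxrank0 eq_sym -lt0n; have /mx_irrP[] := irr.
  apply: (ind_restr_eq0 (rG := R) (P := supp_mx K) sKL sLG _ (supp_mxK K)) => //.
  - by move=> g _ ngK; apply: supp_mx_disj.
  - apply: submx_trans (supp_mx_sub (subxx K) sKL sLG).
    by rewrite eB -AL submxMl.
  - by move=> g gL; rewrite -hB // submxMl.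
pose S := \sum_(k in K) tau k.
have nzS : S != 0.
  apply: contra_neqN nzBP => /eqP S0.
  have : S *m B *m supp_mx K = #|K|%:R *: (B *m supp_mx K).
    rewrite !mulmx_suml (eq_bigr (fun=> B *m supp_mx K)) ?sumr_const ?scaler_nat //.
    move=> k kK; rewrite hB ?(subsetP sKL) //.
    by rewrite -mulmxA -supp_mxC // supp_mx_base.
  rewrite S0 !mul0mx => /esym/eqP; rewrite scaler_eq0 pnatr_eq0.
  by rewrite -[_ == 0%N]negbK -lt0n cardG_gt0 => /eqP.
have: (S <= rfix_mx tau K)%MS.
  apply/rfix_mxP=> k kK; rewrite mulmx_suml [RHS](reindex_inj (mulIg k)) /=.
  apply: eq_big => [g|g gK]; first by rewrite groupMr.
  by rewrite repr_mxM ?(subsetP sKL).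
by apply: contraTneq => ->; rewrite submx0.
Qed.

End PermutationRepresentation.

(** * The subspaces attached to initial segments of paths *)

Lemma the_copyP (C : numClosedFieldType) (gT : finGroupType) (G H : {group gT})
    (n d : nat) (rG : mx_representation C G n) (sigma : mx_representation C H d)
    (W A : 'M_n) :
  (A <= W)%MS -> is_copy rG sigma A ->
  (the_copy rG sigma W <= W)%MS /\ is_copy rG sigma (the_copy rG sigma W).
Proof.
move=> sAW cpA; rewrite /the_copy.
pose P U := (U <= W)%MS /\ is_copy rG sigma U.
by apply: (@classical_sets.xgetPex _ 0 P); exists A.
Qed.

Lemma simple_irr_repr (C : numClosedFieldType) (gT : finGroupType)
    (G H : {group gT}) (n : nat) (rG : mx_representation C G n)
    (sHG : H \subset G) (A : 'M_n) :
  mxsimple (subg_repr rG sHG) A ->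
  exists theta : Irr C H, is_copy rG (irr_repr theta) A.
Proof.
move=> /simple_is_copy[d [sigma [irr cpA]]]; exists (irr_comp (Irr C H) sigma).
apply: is_copy_trans cpA; apply/mx_rsim_sym.
exact: rsim_irr_comp_pchar (num_group_char _) _ _ irr.
Qed.

Section Paths.

Context {C : numClosedFieldType} {gT : finGroupType} {m : nat}.
Context {H : 'I_m.+1 -> {group gT}}.
Hypothesis Hchain : forall i : 'I_m, H (inord i) \subset H (inord i.+1).
Hypothesis HGT : Gelfand_Tsetlin C H (H ord0).

Local Notation K := (H ord0).
Local Notation G := (H ord_max).
Local Notation R := (LX_repr C G K).
Local Notation Hn k := (H (inord k)).
Local Notation D k := (@supp_mx C gT G K (Hn k)).
Implicit Types c d : pathType C H.

Let inord0 : inord 0 = ord0 :> 'I_m.+1.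
Proof. by apply: val_inj; rewrite /= inordK. Qed.

Let inord_max : inord m = ord_max :> 'I_m.+1.
Proof. by apply: val_inj; rewrite /= inordK. Qed.

Lemma chainS k : (k < m)%N -> Hn k \subset Hn k.+1.
Proof. by move=> ltkm; apply: (Hchain (Ordinal ltkm)). Qed.

Lemma chain_base k : (k <= m)%N -> K \subset Hn k.
Proof.
elim: k => [|k IHk] lekm; first by rewrite inord0.
exact: subset_trans (IHk (ltnW lekm)) (chainS lekm).
Qed.

Lemma chain_top k : (k <= m)%N -> Hn k \subset G.
Proof.
move=> lekm; suff sHn j : (k + j <= m)%N -> Hn k \subset Hn (k + j).
  by have := sHn (m - k)%N; rewrite subnKC // inord_max; apply.
elim: j => [|j IHj]; rewrite ?addn0 // addnS => ltjm.
exact: subset_trans (IHj (ltnW ltjm)) (chainS ltjm).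
Qed.

Let sKG : K \subset G.
Proof. by rewrite -inord_max chain_base. Qed.

(** Paths are total functions on the indices, and a segment is represented by
    any path that restricts to it: this keeps a single type of paths throughout
    the induction on k, at the price of counting each segment many times in
    sums over paths. *)
Definition truncated_path c k :=
  (forall i, (i <= k)%N -> has_invariants K (irr_repr (c (inord i)))) /\
  (forall i, (i < k)%N -> edge (c (inord i)) (c (inord i.+1))).

Lemma truncated_pathS c k : truncated_path c k.+1 -> truncated_path c k.
Proof.
by move=> [inv edg]; split=> i leik; [apply: inv | apply: edg]; apply: leqW.
Qed.

Lemma VC_step_ext c d k :
  (forall i, (i <= k)%N -> c (inord i) = d (inord i)) ->
  VC_step G K c k = VC_step G K d k.
Proof.
elim: k => //= k IHk eqcd; rewrite IHk ?eqcd // => i leik; apply: eqcd.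
exact: leqW.
Qed.

Lemma supp_mx_chain k : (k < m)%N -> D k *m D k.+1 = D k.
Proof. by move=> ltkm; rewrite supp_mxM (finset.setIidPl (chainS ltkm)). Qed.

Let DC k h : h \in Hn k -> D k *m R h = R h *m D k.
Proof. exact: supp_mxC. Qed.

Let D0 k g : g \in Hn k.+1 -> g \notin Hn k -> D k *m R g *m D k = 0.
Proof. by move=> _; apply: supp_mx_disj. Qed.

Lemma VC_step_copy c k :
  (k <= m)%N -> truncated_path c k ->
  is_copy R (irr_repr (c (inord k))) (VC_step G K c k) /\
  VC_step G K c k *m D k = VC_step G K c k.
Proof.
elim: k => [|k IHk] lekm pc.
  split.
    have := pc.1 0%N isT; rewrite /= inord0 => inv.
    by apply: LKK_copy => //; apply: socle_irr.
  have : (LKK C G K <= D 0)%MS by rewrite inord0 LKK_supp.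
  by case/submxP=> X /= ->; rewrite -mulmxA supp_mxK.
have [cp VD] := IHk (ltnW lekm) (truncated_pathS pc).
have [A sA cpA] := ind_copy_exists (chainS lekm) (chain_top lekm) (@DC k) (@D0 k)
  cp VD (socle_irr _) (socle_irr _) (pc.2 k (leqnn _)).
have [sV cpV] := the_copyP sA cpA; split=> //.
apply: ind_fix sV; [exact: chainS|by rewrite -VD -mulmxA supp_mx_chain|].
by move=> g; apply: supp_mxC.
Qed.

(** The existence of a copy rests on Frobenius reciprocity alone; the
    Gelfand-Tsetlin condition enters here. *)
Lemma VC_step_uniq c k A :
  (k < m)%N -> truncated_path c k.+1 ->
  is_copy R (irr_repr (c (inord k.+1))) A ->
  (A <= ind_space R (Hn k) (Hn k.+1) (VC_step G K c k))%MS ->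
  (A :=: VC_step G K c k.+1)%MS.
Proof.
move=> ltkm pc cpA sA.
have [cp VD] := VC_step_copy (ltnW ltkm) (truncated_pathS pc).
have [sV cpV] := the_copyP sA cpA.
apply: (ind_copy_uniq (chainS ltkm) (chain_top ltkm) (@D0 k) cp VD _ (socle_irr _)
  cpA cpV sA sV) => e theta.
exact: (HGT (i := Ordinal ltkm) (socle_irr _) (pc.1 k (leqnSn k))).
Qed.

Lemma VC_step_sub c k :
  (k < m)%N -> truncated_path c k.+1 ->
  (VC_step G K c k.+1 <= ind_space R (Hn k) (Hn k.+1) (VC_step G K c k))%MS.
Proof.
move=> ltkm pc; have [cp VD] := VC_step_copy (ltnW ltkm) (truncated_pathS pc).
have [A sA cpA] := ind_copy_exists (chainS ltkm) (chain_top ltkm) (@DC k) (@D0 k)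
  cp VD (socle_irr _) (socle_irr _) (pc.2 k (leqnn _)).
by have [] := the_copyP sA cpA.
Qed.

Lemma copies_orth (L : {group gT}) (s t : Irr C L) (A B : 'M_#|lcosets K G|) :
  s != t -> is_copy R (irr_repr s) A -> is_copy R (irr_repr t) B ->
  A *m B^t* = 0.
Proof.
move=> nst /is_copyP[sLG [BA [_ eA hA]]] /is_copyP[_ [BB [_ eB hB]]].
apply: (@orth_sub _ _ _ _ _ _ BA BB); rewrite ?eA ?eB //.
apply: (@intertwines_orth _ _ L _ (irr_repr s) _ (irr_repr t) _ R) => //.
- by move=> h hL; apply: LX_adj; rewrite (subsetP sLG).
- exact: socle_irr.
- exact: socle_irr.
- by move/socle_rsimP; apply/negP.
Qed.

(** At index 0 segments cannot differ, K having a single irreducible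
    representation with invariant vectors. *)
Lemma VC_step_orth c d k :
  (k <= m)%N -> truncated_path c k -> truncated_path d k ->
  (exists2 i, (i <= k)%N & c (inord i) <> d (inord i)) ->
  VC_step G K c k *m (VC_step G K d k)^t* = 0.
Proof.
elim: k => [|k IHk] lekm pc pd [i leik ncd].
  case: ncd; move: leik; rewrite leqn0 => /eqP->.
  have := (pc.1 0%N isT, pd.1 0%N isT); rewrite inord0 => -[invc invd].
  by apply/eqP/socle_rsimP; apply: irr_invariants_rsim => //; apply: socle_irr.
have [cpc VDc] := VC_step_copy (ltnW lekm) (truncated_pathS pc).
have [cpd VDd] := VC_step_copy (ltnW lekm) (truncated_pathS pd).
move: leik; rewrite leq_eqVlt => /orP[/eqP ei|]; last first.
  rewrite ltnS => leik.
  apply: orth_sub (VC_step_sub lekm pc) (VC_step_sub lekm pd) _.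
  apply: (ind_orth (P := D k) (chainS lekm) (chain_top lekm) (@D0 k)) => //.
  - by move=> g gL; apply: LX_adj; rewrite (subsetP (chain_top lekm)).
  - exact: supp_mx_adj.
  - by apply: IHk => //; [exact: ltnW|exact: truncated_pathS|
      exact: truncated_pathS|exists i].
rewrite ei in ncd; apply: copies_orth (VC_step_copy lekm pc).1 (VC_step_copy lekm pd).1.
exact/eqP.
Qed.

(** An irreducible constituent of the space induced along a segment is labelled
    by some theta; replacing the value of the path at the next index by theta
    gives a segment whose subspace is that constituent. The new value has
    invariant vectors by [copy_has_invariants] and is joined by an edge by
    [ind_copy_edge]. *)
Lemma supp_mx_sub_sum k :
  (k <= m)%N ->
  (D k <= \sum_(c : pathType C H | `[< truncated_path c k >]) VC_step G K c k)%MS.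
Proof.
elim: k => [|k IHk] lekm.
  have sDG : Hn 0 \subset G by apply: chain_top.
  have modD : mxmodule (subg_repr R sDG) (D 0).
    by apply/mxmoduleP=> h hH; rewrite /= DC ?submxMl.
  have [I W S simW sumW _] := num_semisimple modD.
  rewrite -sumW /S; apply/sumsmx_subP=> i _.
  have [theta cpW] := simple_irr_repr (simW i).
  pose c : pathType C H :=
    [ffun j => dfwith (fun j => principal_comp (Irr C (H j))) theta j].
  have ec : c (inord 0) = theta by rewrite ffunE dfwith_in.
  have pc : truncated_path c 0.
    split=> // j; rewrite leqn0 => /eqP->; rewrite ec.
    apply: copy_has_invariants cpW _ => //.
    - exact: chain_base.
    - exact: socle_irr.
    have /submxP[X ->] : (W i <= D 0)%MS by rewrite -sumW /S (sumsmx_sup i).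
    by rewrite -mulmxA supp_mxK.
  rewrite (sumsmx_sup c) //; first exact/asboolP.
  have : (W i <= D 0)%MS by rewrite -sumW /S (sumsmx_sup i).
  by rewrite inord0 /= LKK_supp.
have sHL := chainS lekm; have sLG := chain_top lekm.
pose I k U := ind_space R (Hn k) (Hn k.+1) U.
have : (D k.+1 <= \sum_(c : pathType C H | `[< truncated_path c k >])
          I k (VC_step G K c k))%MS.
  apply: submx_trans (supp_mx_sub (chain_base (ltnW lekm)) sHL sLG) _.
  apply/sumsmx_subP=> A AHL; rewrite /lact.
  apply: submx_trans (submxMr _ (IHk (ltnW lekm))) _; rewrite sumsmxMr.
  apply/sumsmx_subP=> c pc; rewrite (sumsmx_sup c) //.
  by rewrite /I /ind_space (sumsmx_sup A).
move/submx_trans; apply; apply/sumsmx_subP=> c /asboolP pc.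
have [cp VD] := VC_step_copy (ltnW lekm) pc; have [inv edg] := pc.
have [J W S simW sumW _] := num_semisimple (ind_module sHL sLG cp).
rewrite /I -sumW /S; apply/sumsmx_subP=> i _.
have sWI : (W i <= I k (VC_step G K c k))%MS by rewrite /I -sumW /S (sumsmx_sup i).
have [theta cpW] := simple_irr_repr (simW i).
pose c' : pathType C H := [ffun j => dfwith c theta j].
have ec' : c' (inord k.+1) = theta by rewrite ffunE dfwith_in.
have eqc j : (j <= k)%N -> c' (inord j) = c (inord j).
  move=> lejk; rewrite ffunE dfwith_out //.
  apply/eqP=> /(congr1 val); rewrite /= !inordK ?ltnS //; last first.
    exact: leq_trans lejk (ltnW lekm).
  by move=> e; rewrite -e ltnn in lejk.
have pc' : truncated_path c' k.+1.
  split=> j.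
    rewrite leq_eqVlt => /orP[/eqP->|]; last first.
      by rewrite ltnS => lejk; rewrite eqc //; apply: (inv j lejk).
    rewrite ec'; apply: copy_has_invariants cpW _ => //.
    - exact: chain_base.
    - exact: socle_irr.
    apply: ind_fix sWI; [exact: chainS|by rewrite -VD -mulmxA supp_mx_chain|].
    by move=> g; apply: supp_mxC.
  rewrite ltnS leq_eqVlt => /orP[/eqP->|ltjk]; last first.
    by rewrite !eqc ?(ltnW ltjk) //; apply: (edg j ltjk).
  rewrite ec' eqc //.
  exact: (ind_copy_edge sHL sLG (@DC k) (@D0 k) cp VD (socle_irr _)
    (socle_irr _) cpW sWI).
rewrite (sumsmx_sup c') //; first exact/asboolP.
have eqV := VC_step_ext eqc.
have <- : (W i :=: VC_step G K c' k.+1)%MS; last exact: submx_refl.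
  by apply: VC_step_uniq; rewrite ?ec' ?eqV.
Qed.

(** * The isotypic component and the intertwiner *)

Section Target.

Context {n : nat} {rho : mx_representation C G n}.
Hypothesis rho_irr : mx_irreducible rho.

Lemma rsim_is_copy e (sigma : mx_representation C G e) :
  mx_rsim sigma rho <-> is_copy rho sigma 1%:M.
Proof.
have cp1 : is_copy rho rho 1%:M.
  apply/is_copyP; split=> //; exists 1%:M; split=> //.
    by rewrite row_free_unit unitmx1.
  by move=> h hG; rewrite mul1mx mulmx1.
split=> [sim|cp]; first exact: is_copy_trans cp1.
exact: is_copy_rsim cp cp1.
Qed.

Lemma path_toP c :
  path_to K rho c <->
  truncated_path c m /\ mx_rsim (irr_repr (c ord_max)) rho.
Proof.
split=> [[inv edg cp]|[[inv edg] /rsim_is_copy cp]].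
  split; last exact/rsim_is_copy.
  by split=> [i _|i ltim]; [exact: inv | exact: (edg (Ordinal ltim))].
split=> // [j|i]; last exact: (edg i (ltn_ord i)).
by have := inv j (ltn_ord j); rewrite inord_val.
Qed.

Lemma VC_copy c :
  path_to K rho c -> is_copy R (irr_repr (c ord_max)) (VC G K c).
Proof.
move=> /path_toP[pc _]; have [cp _] := VC_step_copy (leqnn m) pc.
by move: cp; rewrite inord_max.
Qed.

Lemma VC_orth c d :
  truncated_path c m -> truncated_path d m -> c != d ->
  VC G K c *m (VC G K d)^t* = 0.
Proof.
move=> pc pd ncd; apply: VC_step_orth => //; apply: contrapT => eqcd.
case/eqP: ncd; apply/ffunP=> j; apply: contrapT => ncdj; apply: eqcd.
by exists j; rewrite ?inord_val // -ltnS.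
Qed.

Lemma component_VC (U : 'M_#|lcosets K G|) :
  is_copy R rho U ->
  (component_mx R U
     :=: \sum_(c : pathType C H | `[< path_to K rho c >]) VC G K c)%MS.
Proof.
move=> cpU.
have simU : mxsimple R U by apply: (is_copy_simple (subxx G) rho_irr cpU).
(* S2 collects the full paths that do not end in rho *)
set S1 := (\sum_(c | _) _)%MS.
pose Q c := `[< truncated_path c m >] && ~~ `[< path_to K rho c >].
pose S2 := (\sum_(c | Q c) VC G K c)%MS.
have sS1 : (S1 <= component_mx R U)%MS.
  apply/sumsmx_subP=> c /asboolP pc; have [_ sim] := (path_toP c).1 pc.
  have cpV := is_copy_trans (mx_rsim_sym sim) (VC_copy pc).
  have simV : mxsimple R (VC G K c) by apply: (is_copy_simple (subxx G) rho_irr cpV).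
  have [[modU _ _] [modV _ _]] := (simU, simV).
  apply: mx_iso_component => //; apply/(mx_rsim_iso modU modV).
  apply: mx_rsim_trans (mx_rsim_sym _) _; first exact/(is_copy_full rho modU).
  exact/(is_copy_full rho modV).
have orthS2 : component_mx R U *m S2^t* = 0.
  have [I [W isoW ->]] := component_mx_def simU.
  apply: sumsmx_orth => i _; apply: orth_sym.
  apply: sumsmx_orth => c /andP[/asboolP pc /asboolP npc].
  have [cpc _] := VC_step_copy (leqnn m) pc; rewrite inord_max in cpc.
  have simW := mx_iso_simple (isoW i) simU.
  have [theta cpW] := simple_irr_repr (sHG := subxx G) simW.
  apply: (copies_orth _ cpc cpW); apply/eqP=> ec.
  case: npc; apply/path_toP; split=> //.
  rewrite ec; apply: is_copy_rsim cpW _.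
  have [[modU _ _] [modW _ _]] := (simU, simW).
  apply/(is_copy_full rho modW).
  apply: mx_rsim_trans (_ : mx_rsim rho (submod_repr modU)) _.
    exact/(is_copy_full rho modU).
  by apply/(mx_rsim_iso modU modW).
have sum1 : (1%:M <= S1 + S2)%MS.
  have := supp_mx_sub_sum (leqnn m); rewrite inord_max supp_mxG // => /submx_trans; apply.
  apply/sumsmx_subP=> c pc.
  have [pr|npr] := boolP `[< path_to K rho c >].
    by apply: submx_trans (addsmxSl _ _); apply: (sumsmx_sup c).
  by apply: submx_trans (addsmxSr _ _); apply: (sumsmx_sup c); rewrite // /Q pc.
apply/eqmxP; rewrite sS1 andbT.
have /sub_addsmxP[[u1 u2] /= eW] := submx_trans (submx1 (component_mx R U)) sum1.
(* the part of the component in S2 is both in the component and orthogonal to it *)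
suff u20 : u2 *m S2 = 0 by rewrite eW u20 addr0 submxMl.
apply: adjmx_mul_eq0.
have su2 : (u2 *m S2 <= component_mx R U)%MS.
  have -> : u2 *m S2 = component_mx R U - u1 *m S1 by rewrite eW addrC addKr.
  by rewrite addmx_sub // eqmx_opp mulmx_sub.
exact: orth_sub su2 (submxMl u2 S2) orthS2.
Qed.

Hypothesis rho_unitary : forall g, g \in G -> rho g \is unitarymx.

Lemma unitary_adj g : g \in G -> rho g^-1%g = (rho g)^t*.
Proof.
move=> gG; have /unitarymxP uu := rho_unitary gG.
rewrite -[LHS]mulmx1 -uu mulmxA -repr_mxM ?groupV // mulVg repr_mx1 mul1mx.
by [].
Qed.

(** The matrix of T_v without the factor sqrt(d_rho / |X|). *)
Definition coef_mx (v : 'rV[C]_n) : 'M[C]_(n, #|lcosets K G|) :=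
  \matrix_(a, i) (v *m rho (repr (enum_val i : {set gT}))^-1%g)^t* a 0.

Lemma intertwinerE v w :
  intertwiner K rho v w = sqrtC (n%:R / #|lcosets K G|%:R) *: (w *m coef_mx v).
Proof.
apply/rowP=> i; rewrite !mxE dotmxE mxE; congr (_ * _).
by apply: eq_bigr => a _; rewrite [in RHS]mxE.
Qed.

Lemma mul_coef_mx p (X : 'M[C]_(p, n)) v b i :
  (X *m coef_mx v) b i
    = (X *m (v *m rho (repr (enum_val i : {set gT}))^-1%g)^t* ) b 0.
Proof. by rewrite !mxE; apply: eq_bigr => a _; rewrite [in LHS]mxE. Qed.

(** The coset g x has a representative of its own, which differs from g times
    that of x by an element of K; this is where v must be K-invariant. *)
Lemma coef_mx_hom v :
  (forall k, k \in K -> v *m rho k = v) ->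
  forall g, g \in G -> rho g *m coef_mx v = coef_mx v *m R g.
Proof.
move=> vK g gG; apply/matrixP=> a i; rewrite mul_coef_mx.
have giX : (g *: enum_val i)%g \in lcosets K G.
  by have [x xG ->] := point_repr i; rewrite -lcosetM lcoset_mem_lcosets ?groupM.
pose j := enum_rank_in giX (g *: enum_val i)%g.
have ej : enum_val j = (g *: enum_val i)%g :> {set gT} by rewrite enum_rankK_in.
have -> : (coef_mx v *m R g) a i = coef_mx v a j.
  rewrite mxE (bigD1 j) //= big1 ?addr0 => [|k nkj].
    by rewrite [X in _ * X]mxE ej eqxx mulr1.
  rewrite [X in _ * X]mxE -ej (inj_eq enum_val_inj) (negPf nkj); exact: mulr0.
rewrite [RHS]mxE -[rho g]trmxCK -adjmxM -unitary_adj // -mulmxA.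
have ri := repr_point i; have rj := repr_point j.
have [x xG ei] := point_repr i.
have riG : repr (enum_val i : {set gT}) \in G.
  move: ri; rewrite {2}ei => /lcosetP[k kK ->].
  by rewrite groupM // (subsetP sKG).
rewrite -repr_mxM ?groupV // -invMg.
congr ((_ ^t* ) a 0).
have {}rj : (g^-1 * repr (enum_val j : {set gT}))%g \in (enum_val i : {set gT}).
  by rewrite -mem_lcoset -ej.
set ri' := repr _ in ri riG *; set rj' := repr _ in rj *.
have [k kK ->] : exists2 k, k \in K & rj' = (g * ri' * k)%g.
  exists ((g * ri')^-1 * rj')%g; last by rewrite mulKVg.
  by move: ri rj; rewrite ei => /lcoset_eqP <-; rewrite mem_lcoset mulgA -invMg.
have kG : k \in G := subsetP sKG _ kK.
rewrite [in RHS]invMg [in RHS]repr_mxM ?groupV ?groupM //.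
by rewrite mulmxA [v *m rho k^-1%g]vK ?groupV.
Qed.

Lemma intertwiner_VC c v w :
  path_to K rho c -> GT_vector rho c v -> (intertwiner K rho v w <= VC G K c)%MS.
Proof.
move=> /path_toP[pc sim] [V [V1 Vinc cpV vV _]].
have [inv edg] := pc.
(* V ord0 has the trivial type, being irreducible with invariant vectors *)
have vK k : k \in K -> v *m rho k = v.
  move=> kK; have /is_copyP[_ [B [_ eB hB]]] := cpV ord0.
  have inv0 : has_invariants K (irr_repr (c ord0)).
    by have := inv 0%N isT; rewrite inord0.
  have [_ triv] := irr_invariants_trivial (socle_irr _) inv0.
  have /submxP[X ->] : (v <= B)%MS by rewrite eB.
  by rewrite -mulmxA -hB // triv // mul1mx.
have homT := coef_mx_hom vK; set T := coef_mx v in homT.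
have vVk k : (k <= m)%N -> (v <= V (inord k))%MS.
  elim: k => [|k IHk] lekm; first by rewrite inord0.
  exact: submx_trans (IHk (ltnW lekm)) (Vinc (Ordinal lekm)).
suff TD k : (k <= m)%N -> (T *m D k <= VC_step G K c k)%MS.
  have := TD m (leqnn m); rewrite inord_max supp_mxG // mulmx1 => sT.
  by rewrite intertwinerE scalemx_sub // mulmx_sub.
elim: k => [|k IHk] lekm; first by rewrite inord0 /= LKK_supp submxMl.
have sHL := chainS lekm; have sLG := chain_top lekm.
have pc' : truncated_path c k.+1.
  split=> i lei; first exact: inv (leq_trans lei lekm).
  exact: edg (leq_trans lei lekm).
(* T P_{k+1} is the sum of the translates of T P_k *)
have sInd : (T *m D k.+1 <= ind_space R (Hn k) (Hn k.+1) (VC_step G K c k))%MS.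
  rewrite (supp_mx_lcosets (chain_base (ltnW lekm)) sHL sLG) mulmx_sumr.
  apply: summx_sub => A AHL; rewrite (sumsmx_sup A) // /lact !mulmxA.
  have aG : repr A \in G by rewrite (subsetP sLG) // (repr_lcoset_sub sHL).
  rewrite -homT // -(mulmxA (rho _)) submxMr // mulmx_sub //.
  exact: IHk (ltnW lekm).
have /is_copyP[_ [B [fB eB hB]]] := cpV (inord k.+1).
have homB : intertwines (Hn k.+1) (irr_repr (c (inord k.+1))) R (B *m (T *m D k.+1)).
  move=> h hL; rewrite !mulmxA hB // -(mulmxA B) homT ?(subsetP sLG) //.
  by rewrite -!mulmxA supp_mxC.
(* T P_{k+1} kills the orthogonal complement of V_{k+1}, so that it has the same
   image as its restriction to the irreducible H_{k+1}-space V_{k+1} *)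
have sTB : (T *m D k.+1 <= B *m (T *m D k.+1))%MS.
  set W := V (inord k.+1) in eB.
  have [W' W'W addW] : exists2 W' : 'M_n, W' *m W^t* = 0 & (W + W' :=: 1%:M)%MS.
    by eexists; [apply/orthomx1P; exact: submx_refl | exact: addsmx_ortho].
  have W'T : W' *m (T *m D k.+1) = 0.
    rewrite mulmxA; apply/matrixP=> a i; rewrite mul_mx_diag [LHS]mxE [RHS]mxE.
    rewrite mul_coef_mx [X in _ * X]mxE.
    case: (boolP (_ \subset _)) => sk; last exact: mulr0.
    have rk := subsetP sk _ (repr_point i).
    have sW : (v *m rho (repr (enum_val i : {set gT}))^-1%g <= W)%MS.
      apply: submx_trans (submxMr _ (vVk _ lekm)) _.
      by apply: is_copy_stable (cpV _) _ _; rewrite groupV.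
    by rewrite (orth_sub (submx_refl W') sW W'W) mxE mul0r.
  have : (1%:M <= B + W')%MS by rewrite (adds_eqmx eB (eqmx_refl W')) addW.
  case/sub_addsmxP=> [[u1 u2] /= e1].
  by rewrite -[X in (X <= _)%MS]mul1mx e1 mulmxDl -!mulmxA W'T mulmx0 addr0 submxMl.
apply: submx_trans sTB _.
have [->|nz] := eqVneq (B *m (T *m D k.+1)) 0; first exact: sub0mx.
have cpT := is_copy_genmx sLG (socle_irr _) homB nz.
rewrite -(genmxE (B *m _)) (VC_step_uniq lekm pc' cpT) //.
by rewrite genmxE mulmx_sub.
Qed.

End Target.

End Paths.

Theorem theorem2p28 (C : numClosedFieldType) (gT : finGroupType)
    (G K : {group gT}) (m : nat) (H : 'I_m.+1 -> {group gT})
    (HK : H ord0 = K) (HG : H ord_max = G)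
    (Hchain : forall i : 'I_m, H (inord i) \subset H (inord i.+1))
    (HGT : Gelfand_Tsetlin C H K)
    (n : nat) (rho : mx_representation C G n)
    (rho_unitary : forall g, g \in G -> rho g \is unitarymx)
    (rho_irr : mx_irreducible rho)
    (U : 'M[C]_#|lcosets K G|) (rho_in_LX : is_copy (LX_repr C G K) rho U) :
  [/\ (component_mx (LX_repr C G K) U
         :=: \sum_(c : pathType C H | `[< path_to K rho c >]) VC G K c)%MS,
      mxdirect (\sum_(c : pathType C H | `[< path_to K rho c >]) VC G K c),
      forall c d : pathType C H, path_to K rho c -> path_to K rho d -> c != d ->
        forall f1 f2 : 'rV[C]_#|lcosets K G|,
          (f1 <= VC G K c)%MS -> (f2 <= VC G K d)%MS -> dotmx f1 f2 = 0
    & forall c : pathType C H, path_to K rho c ->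
        forall v : 'rV[C]_n, GT_vector rho c v ->
        forall w : 'rV[C]_n, (intertwiner K rho v w <= VC G K c)%MS].
Proof.
subst K G.
have orthV (c d : pathType C H) :
    path_to (H ord0) rho c -> path_to (H ord0) rho d -> c != d ->
    VC (H ord_max) (H ord0) c *m (VC (H ord_max) (H ord0) d)^t* = 0.
  by move=> /path_toP[pc _] /path_toP[pd _]; apply: VC_orth.
split.
- exact: component_VC.
- by apply: orth_direct => c d /asboolP pc /asboolP pd; apply: orthV.
- move=> c d pc pd ncd f1 f2 sf1 sf2.
  by rewrite dotmxE (orth_sub sf1 sf2 (orthV c d pc pd ncd)) mxE.
- by move=> c pc v gtv w; apply: intertwiner_VC.
Qed.
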